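(* Fix the number of machines $m$. For every fixed $\varepsilon>0$, the branch-and-bound algorithm $A^{\text{unrel}}_{\varepsilon}$ (described in the context), run on any instance of the unrelated parallel machine scheduling problem with $m$ machines, returns a schedule whose makespan is at most $(1+\varepsilon)$ times the optimal makespan, after processing at most $m^{\lfloor m^2/\varepsilon\rfloor}$ nodes of the branching tree.
   Context: Unrelated parallel machine scheduling: $n$ jobs and $m$ machines; job $j$ has processing time $p_{j,i}\in\mathbb N$ on machine $i$. A schedule assigns each job to one machine; the completion time of a machine is the sum of the processing times of its jobs (plus its overhead $t_i$, if any), and the makespan is the maximum completion time; the goal is to minimize the makespan. With overheads $\mathbf t=(t_1,\dots,t_m)\in\mathbb N^m$ and a value $T$, let $S_T=\{(j,i):p_{j,i}\le T\}$ and let $PARTIAL\text{-}LP\text{-}MS_m(\mathbf P,\mathbf t,T)$ be the polyhedron of vectors $(x_{j,i})_{(j,i)\in S_T}$ with $\sum_{i:(j,i)\in S_T}x_{j,i}=1$ for every job $j$, $\sum_{j:(j,i)\in S_T}p_{j,i}x_{j,i}\le T-t_i$ for every machine $i$, and $x\ge 0$. A job $j$ is fractional in $\mathbf x$ if some $x_{j,i}\notin\{0,1\}$. Algorithm $A^{\text{unrel}}_{\varepsilon}$: each node $v$ is specified by a set of fixed job–machine pairs $(j_z,i_z)$ along its root path; it encodes the instance on the unfixed jobs with overheads $t_i=\sum_{z:i_z=i}p_{j_z,i}$ (initially $\mathbf t=\mathbf 0$). Bounding at $v$: $LB(v)=T'$, the smallest integer $T$ for which $PARTIAL\text{-}LP\text{-}MS_m(\mathbf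 P_v,\mathbf t_v,T)$ is nonempty (found by binary search); a vertex of this polyhedron is rounded to an integer schedule by keeping integral jobs and assigning each fractional job to the machine where its processing time is minimal; $UB(v)$ is the makespan of the resulting complete schedule (including the fixed jobs). Branching: among the fractional jobs of the vertex, pick the job $j$ maximizing $\min_i p_{j,i}$; create $m$ children, the $i$-th fixing $j$ to machine $i$ (increasing $t_i$ by $p_{j,i}$). Children whose lower bound exceeds the makespan of an already found schedule are pruned. Selection (best-first): the active node with smallest $LB$ is processed next. $LLB$ is the minimum $LB$ over active nodes and $LUB$ the best makespan found so far; the algorithm terminates as soon as $LUB/LLB\le 1+\varepsilon$, returning the best schedule found. *)

(* Defs.v *)
From mathcomp Require Import all_boot all_order all_algebra.
Set Implicit Arguments.
Unset Strict Implicit.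
Unset Printing Implicit Defensive.
Import Order.TTheory GRing.Theory Num.Theory.
Local Open Scope ring_scope.

(* The minimum of [f] over an inhabited [T]: as [nat] has no top element, the
   iteration of [minn] starts from the maximum of [f]. *)
Definition minval (T : finType) (f : T -> nat) : nat :=
  \big[minn/(\max_x f x)%N]_x f x.

Lemma minval_le (T : finType) (f : T -> nat) (x : T) : (minval f <= f x)%N.
Proof.
rewrite /minval; set d := (\max_x f x)%N; clearbody d.
move: (mem_index_enum x); elim: (index_enum T) => // y r IHr.
rewrite inE big_cons geq_min => /predU1P[->|/IHr ->]; first by rewrite leqnn.
exact: orbT.
Qed.

Lemma minval_attained (T : finType) (f : T -> nat) (x0 : T) :
  exists x, minval f = f x.
Proof.
rewrite /minval; elim/big_ind: _ => [|a b [x ->] [y ->]|x _]; last by exists x.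
- have [|x ->] := @bigop.eq_bigmax T f; last by exists x.
  by apply/card_gt0P; exists x0.
- by rewrite /minn; case: ifP => _; [exists x | exists y].
Qed.

(* Jobs are ['I_n], machines are ['I_m]; [p j i] is the processing time of job
   [j] on machine [i]. *)

Definition schedule (n m : nat) := {ffun 'I_n -> 'I_m}.

Definition makespan n m (p : 'I_n -> 'I_m -> nat) (sigma : schedule n m) : nat :=
  (\max_(i < m) \sum_(j < n | sigma j == i) p j i)%N.

Definition opt_makespan n m (p : 'I_n -> 'I_m -> nat) : nat :=
  minval (fun sigma : schedule n m => makespan p sigma).

(* Feasible points of PARTIAL-LP-MS on the jobs of [U], with overheads [t].
   A vector indexed by S_T is encoded as an n x m matrix that vanishes outside
   of S_T; the map is affine and injective, so vertices are preserved. *)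
Definition partial_lp (R : numDomainType) n m (p : 'I_n -> 'I_m -> nat)
    (U : {set 'I_n}) (t : 'I_m -> nat) (T : nat) (x : 'M[R]_(n, m)) : Prop :=
  [/\ forall j, j \in U -> \sum_(i < m | (p j i <= T)%N) x j i = 1,
      forall i, \sum_(j < n | (j \in U) && (p j i <= T)%N) (p j i)%:R * x j i
                  <= T%:R - (t i)%:R,
      forall j i, j \in U -> (p j i <= T)%N -> 0 <= x j i
    & forall j i, ~~ ((j \in U) && (p j i <= T)%N) -> x j i = 0].

(* Vertices of a polyhedron, as its extreme points. *)
Definition vertex (R : numDomainType) n m (K : 'M[R]_(n, m) -> Prop)
    (x : 'M[R]_(n, m)) : Prop :=
  K x /\ forall (y z : 'M[R]_(n, m)) (a : R), K y -> K z -> 0 < a -> a < 1 ->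
    x = a *: y + (1 - a) *: z -> y = x /\ z = x.

(* A node of the branching tree after bounding. [fixed] lists the pairs
   (job, machine) fixed along the root path. *)
Record bb_node (R : Type) (n m : nat) := BBNode {
  fixed : seq ('I_n * 'I_m);
  lb : nat;
  lpsol : 'M[R]_(n, m);
  rounded : schedule n m
}.

Definition unfixed n m (F : seq ('I_n * 'I_m)) : {set 'I_n} :=
  [set j | j \notin map fst F].

Definition overhead n m (p : 'I_n -> 'I_m -> nat) (F : seq ('I_n * 'I_m))
    (i : 'I_m) : nat :=
  (\sum_(z <- F | z.2 == i) p z.1 i)%N.

Definition node_lp (R : numDomainType) n m (p : 'I_n -> 'I_m -> nat)
    (F : seq ('I_n * 'I_m)) (T : nat) : 'M[R]_(n, m) -> Prop :=
  partial_lp p (unfixed F) (overhead p F) T.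

Definition ub (R : Type) n m (p : 'I_n -> 'I_m -> nat) (v : bb_node R n m) : nat :=
  makespan p (rounded v).

Definition fractional (R : numDomainType) n m (v : bb_node R n m) (j : 'I_n) : bool :=
  (j \in unfixed (fixed v)) &&
  [exists i, (lpsol v j i != 0) && (lpsol v j i != 1)].

(* All choices that the algorithm leaves open (vertex, machine minimizing a
   processing time, branching job, selected node) are left nondeterministic.
   [T] ranges over [nat]: if [0 < m], no negative [T] is feasible. *)
Definition bounded (R : numDomainType) n m (p : 'I_n -> 'I_m -> nat)
    (v : bb_node R n m) : Prop :=
  [/\ forall T, (exists x : 'M[R]_(n, m), node_lp p (fixed v) T x) -> (lb v <= T)%N,
      vertex (@node_lp R n m p (fixed v) (lb v)) (lpsol v),
      forall z, z \in fixed v -> rounded v z.1 = z.2,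
      forall j, j \in unfixed (fixed v) -> ~~ fractional v j ->
        lpsol v j (rounded v j) = 1
    & forall j, fractional v j -> p j (rounded v j) = minval (p j)].

Definition branching_job (R : numDomainType) n m (p : 'I_n -> 'I_m -> nat)
    (v : bb_node R n m) (j : 'I_n) : Prop :=
  fractional v j /\
  forall j', fractional v j' -> (minval (p j') <= minval (p j))%N.

Record bb_state (R : Type) (n m : nat) := BBState {
  active : seq (bb_node R n m);
  incumbent : schedule n m
}.

(* LUB / LLB <= 1 + eps, without division, as LLB may be 0. *)
Definition bb_done (R : numDomainType) n m (p : 'I_n -> 'I_m -> nat) (eps : R)
    (s : bb_state R n m) : bool :=
  all (fun v => (makespan p (incumbent s))%:R <= (1 + eps) * (lb v)%:R) (active s).

Definition bb_init (R : numDomainType) n m (p : 'I_n -> 'I_m -> nat)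
    (s : bb_state R n m) : Prop :=
  exists v : bb_node R n m,
    [/\ fixed v = [::], bounded p v & s = BBState [:: v] (rounded v)].

Definition add_child (R : numDomainType) n m (p : 'I_n -> 'I_m -> nat)
    (s : bb_state R n m) (c : bb_node R n m) : bb_state R n m :=
  if (makespan p (incumbent s) < lb c)%N then s
  else BBState (c :: active s)
         (if (ub p c < makespan p (incumbent s))%N then rounded c else incumbent s).

(* Processing of a node [v] that is active with the smallest lower bound. *)
Inductive bb_step (R : numDomainType) n m (p : 'I_n -> 'I_m -> nat) (eps : R) :
    bb_state R n m -> bb_state R n m -> Prop :=
| BBStep (A1 A2 : seq (bb_node R n m)) (v : bb_node R n m) (sigma : schedule n m)
    (j : 'I_n) (child : 'I_m -> bb_node R n m) :
    ~~ bb_done p eps (BBState (A1 ++ v :: A2) sigma) ->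
    all (fun w => (lb v <= lb w)%N) (A1 ++ v :: A2) ->
    branching_job p v j ->
    (forall i, fixed (child i) = (j, i) :: fixed v /\ bounded p (child i)) ->
    bb_step p eps (BBState (A1 ++ v :: A2) sigma)
      (foldl (add_child p) (BBState (A1 ++ A2) sigma)
             [seq child i | i <- enum 'I_m]).

(* [bb_reach p eps k s]: some run is in state [s] after branching on [k] nodes.
   The number of processed nodes is then [k.+1]: the [k] branched ones, and the
   one under examination in [s], at which the run may stop. *)
Inductive bb_reach (R : numDomainType) n m (p : 'I_n -> 'I_m -> nat) (eps : R) :
    nat -> bb_state R n m -> Prop :=
| BBReach0 s : bb_init p s -> bb_reach p eps 0 s
| BBReachS k s s' : bb_reach p eps k s -> bb_step p eps s s' ->
    bb_reach p eps k.+1 s'.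

(* Main.v *)
(* Write [l] for the lower bound of a node and [I] for the incumbent makespan.
   A vertex of the LP has at most [m] fractional jobs, so rounding costs at most
   [m * q], where [q] is the least processing time of the branching job; hence
   [I <= l + m * q] at every branched node. Lower bounds increase and [I]
   decreases along a path, so this remains true, at any later node on the path,
   of every job fixed above it. As long as [(1 + eps) * l < I], all these jobs
   thus have processing times above [eps * l / m], while the LP bounds the total
   load by [m * l]; so branched nodes have depth less than [m ^ 2 / eps - 1].
   A branching job can only exist if [1 < m], and the tree then has fewer than
   [m ^ D] nodes of depth less than [D = floor (m ^ 2 / eps)]. *)

Require Import Defs.
From Stdlib Require Import Classical_Prop.
From HB Require Import structures.
From mathcomp Require Import all_boot all_order all_algebra.
From mathcomp Require Import ring lra.
Import Order.TTheory GRing.Theory Num.Theory.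
Local Open Scope ring_scope.
Set Implicit Arguments.
Unset Strict Implicit.
Unset Printing Implicit Defensive.

(** * Vertices of the LP: number of split jobs, existence *)

Lemma exists_common_scale (R : realFieldType) (C : finType) (a b : C -> R) :
  (forall c, 0 <= b c) -> (forall c, a c != 0 -> 0 < b c) ->
  exists2 d, 0 < d & forall c, d * `|a c| <= b c.
Proof.
move=> b0 ab; exists (\big[Num.min/1]_(c | a c != 0) (b c / `|a c|)).
  by apply: lt_bigmin => [|c ac]; rewrite ?ltr01// divr_gt0 ?ab ?normr_gt0//.
move=> c; have [->|ac] := eqVneq (a c) 0; first by rewrite normr0 mulr0 b0.
by rewrite -ler_pdivlMr ?normr_gt0// bigmin_le_cond.
Qed.

Section PartialLP.
Context (R : realFieldType) (n m : nat) (p : 'I_n -> 'I_m -> nat).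
Context (U : {set 'I_n}) (t : 'I_m -> nat) (T : nat).
Implicit Types x y z : 'M[R]_(n, m).
Let K := @partial_lp R n m p U t T.

Lemma partial_lp_ge0 x j i : K x -> 0 <= x j i.
Proof.
case=> _ _ x0 xN; have [/andP[]|/xN->//] := boolP ((j \in U) && (p j i <= T)%N).
exact: x0.
Qed.

Lemma sum_job x j : K x -> j \in U -> \sum_i x j i = 1.
Proof.
move=> [x1 _ _ xN] jU; rewrite -(x1 j jU).
rewrite [LHS](bigID (fun i => (p j i <= T)%N))/= [X in _ + X]big1 ?addr0//.
by move=> k hk; rewrite xN// jU.
Qed.

(** Otherwise [x] would be the midpoint of two other feasible points [x + d *: y] and [x - d *: y]:
    row sums and loads are unchanged, and only positive entries of [x] move. *)
Lemma vertex_direction_eq0 x y : vertex K x ->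
  (forall j i, y j i != 0 -> [/\ j \in U, (p j i <= T)%N & 0 < x j i]) ->
  (forall j, \sum_i y j i = 0) ->
  (forall i, \sum_j (p j i)%:R * y j i = 0) ->
  y = 0.
Proof.
move=> [Kx xext] ysupp yrow ycol.
have [//|c|d d0 dxy] := @exists_common_scale R ('I_n * 'I_m)%type
    (fun c => y c.1 c.2) (fun c => x c.1 c.2).
- by move=> c; apply: partial_lp_ge0.
- by case/ysupp.
(* Stated for [|s| = d] so as to cover both endpoints at once. *)
have Kd s : `|s| = d -> K (x + s *: y).
  case: Kx => x1 xT x0 xN sd; split.
  - move=> j jU; rewrite (eq_bigr _ (fun i _ => mxE _ _ _ _)) big_split/= x1//.
    suff -> : \sum_(i < m | (p j i <= T)%N) (s *: y) j i = 0 by rewrite addr0.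
    rewrite -[RHS](mulr0 s) -[in RHS](yrow j) mulr_sumr.
    rewrite [RHS](bigID (fun i => (p j i <= T)%N))/= [X in _ + X]big1 ?addr0.
      by apply: eq_bigr => i _; rewrite mxE.
    move=> i; have [->|/ysupp[_ ->//]] := eqVneq (y j i) 0; by rewrite mulr0.
  - move=> i; apply: le_trans (xT i); rewrite le_eqVlt; apply/orP; left; apply/eqP.
    rewrite -[RHS]addr0 -[in X in _ = _ + X](mulr0 s) -[in X in _ = _ + X](ycol i).
    rewrite mulr_sumr [X in _ = _ + X](bigID (fun j => (j \in U) && (p j i <= T)%N))/=.
    rewrite [X in _ = _ + (_ + X)]big1 ?addr0 => [|j].
      by rewrite -big_split; apply: eq_bigr => j _; rewrite !mxE/=; ring.
    by have [->|/ysupp[-> ->//]] := eqVneq (y j i) 0; rewrite !mulr0.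
  - move=> j i _ _; rewrite !mxE; have := dxy (j, i); rewrite /= -sd -normrM.
    by rewrite ler_norml lerNl => /andP[+ _] => h; rewrite addrC -lerBlDr sub0r lerNl.
  - move=> j i h; rewrite !mxE xN// add0r.
    have [->|/ysupp[jU pT]] := eqVneq (y j i) 0; first by rewrite mulr0.
    by rewrite jU pT in h.
have [] := xext (x + d *: y) (x + (- d) *: y) (2^-1).
- by apply: Kd; rewrite gtr0_norm.
- by apply: Kd; rewrite normrN gtr0_norm.
- by lra.
- by lra.
- by apply/matrixP => j i; rewrite !mxE; field.
move=> /eqP; rewrite -subr_eq0 addrC addKr scaler_eq0 gt_eqF//= => /eqP//.
Qed.

(** A single nonzero entry in the row would be its whole sum [1]. *)
Lemma split_job_two_machines x j : K x -> j \in U ->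
  [exists i, (x j i != 0) && (x j i != 1)] ->
  exists e : 'I_m * 'I_m, [/\ e.1 != e.2, 0 < x j e.1 & 0 < x j e.2].
Proof.
move=> Kx jU /existsP[i /andP[xi0 xi1]].
have [k ki xk] : exists2 k, i != k & x j k != 0 :> R.
  apply/exists_inP; apply: contraNT xi1; rewrite negb_exists_in => /forall_inP h.
  rewrite -(sum_job Kx jU) (bigD1 i)//= big1 ?addr0// => k; rewrite eq_sym => /h.
  by rewrite negbK => /eqP.
by exists (i, k); split=> //=; rewrite lt_neqAle eq_sym ?xi0 ?xk partial_lp_ge0.
Qed.

(* More than [m] split jobs would leave a nonzero vector in the kernel of the
   [m] machine constraints, each split job moving mass between two of its
   machines. *)
Lemma card_split_jobs x : vertex K x ->
  (#|[set j in U | [exists i, (x j i != 0%R) && (x j i != 1%R)]]| <= m)%N.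
Proof.
move=> vx; have Kx := vx.1.
set F := [set j in U | _]; rewrite leqNgt; apply/negP => mF.
have [k|e eP] := @fin_all_exists _ _ (fun (k : 'I_#|F|) (e : 'I_m * 'I_m) =>
  [/\ e.1 != e.2, 0 < x (enum_val k) e.1 & 0 < x (@enum_val _ (mem F) k) e.2]).
  have := enum_valP k; rewrite inE => /andP[jU]; exact: split_job_two_machines.
(* [D k] moves one unit of the [k]-th split job between its two machines; row [k] of [A] is the
   resulting change of the machine loads. *)
pose D k : 'I_m -> R := fun i => (i == (e k).1)%:R - (i == (e k).2)%:R.
pose A : 'M[R]_(#|F|, m) := \matrix_(k, i) ((p (enum_val k) i)%:R * D k i).
have : kermx A != 0.
  rewrite kermx_eq0 /row_free neq_ltn; apply/orP; left.
  exact: leq_ltn_trans (rank_leq_col A) mF.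
case/rowV0Pn => c /sub_kermxP cA; case/eqP.
pose y : 'M[R]_(n, m) := \matrix_(j, i) \sum_k c 0 k * (j == enum_val k)%:R * D k i.
have yval k i : y (enum_val k) i = c 0 k * D k i.
  rewrite mxE (bigD1 k)//= eqxx mulr1 big1 ?addr0// => l lk.
  by rewrite (inj_eq enum_val_inj) eq_sym (negPf lk) mulr0 mul0r.
have xallowed j i : 0 < x j i -> (p j i <= T)%N.
  have [_ _ _ xN] := Kx; apply: contraTT => h.
  by rewrite xN ?ltxx// negb_and h orbT.
have y0 : y = 0.
  apply: (vertex_direction_eq0 vx).
  - move=> j i; rewrite mxE => /eqP ynz.
    have [k /eqP jk] : exists k, c 0 k * (j == enum_val k)%:R * D k i != 0.
      apply/existsP; apply: contra_notT ynz; rewrite negb_exists => /forallP h.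
      by apply: big1 => k _; apply/eqP; rewrite -[_ == _]negbK.
    have {jk}[jk Dk] : j = enum_val k /\ D k i != 0.
      have [jk'|jk'] := eqVneq j (enum_val k); last first.
        by case: jk; rewrite (negPf jk') mulr0 mul0r.
      by split=> //; apply/eqP => Dk; case: jk; rewrite Dk mulr0.
    have x0 : 0 < x j i.
      have [_ e1 e2] := eP k; rewrite jk.
      move: Dk; rewrite /D; case: (i =P (e k).1) => [->//|_].
      by case: (i =P (e k).2) => [->//|_]; rewrite subrr eqxx.
    have := enum_valP k; rewrite -jk inE => /andP[jU _].
    by split=> //; apply: xallowed.
  - move=> j; under eq_bigr do rewrite mxE.
    rewrite exchange_big big1//= => k _; rewrite -mulr_sumr.
    have delta_sum a : \sum_i (i == a :> 'I_m)%:R = 1 :> R.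
      by rewrite (bigD1 a)//= eqxx big1 ?addr0// => i /negPf->.
    by rewrite big_split/= sumrN !delta_sum subrr mulr0.
  - move=> i; under eq_bigr do rewrite mxE mulr_sumr.
    rewrite exchange_big/=; have /matrixP/(_ 0 i) := cA.
    rewrite !mxE => cAi; rewrite -[RHS]cAi; apply: eq_bigr => k _.
    rewrite (bigD1 (enum_val k))//= eqxx !mxE big1.
      by rewrite mulr1 addr0 mulrCA.
    by move=> j /negPf->; rewrite mulr0 mul0r mulr0.
(* The entry of [y] at the [k]-th split job and machine [(e k).1] is [c 0 k], so [y = 0] forces
   [c = 0]. *)
apply/rowP => k; have := yval k (e k).1; rewrite y0 !mxE /D eqxx.
by have [/negPf-> _ _] := eP k; rewrite subr0 mulr1.
Qed.

(** One index type for both families of inequalities, so that tight constraints can be counted. The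
    equalities are left out: they persist on any line through two feasible points. *)
Definition slack x (c : 'I_n * 'I_m + 'I_m) : R :=
  match c with
  | inl ji => x ji.1 ji.2
  | inr i => T%:R - (t i)%:R
             - \sum_(j < n | (j \in U) && (p j i <= T)%N) (p j i)%:R * x j i
  end.

Lemma slack_ge0 x c : K x -> 0 <= slack x c.
Proof.
move=> Kx; case: c => [[j i]|i] /=; first exact: partial_lp_ge0.
by case: Kx => _ xT _ _; rewrite subr_ge0.
Qed.

Lemma slack_line x y s c :
  slack (x + s *: (y - x)) c = slack x c + s * (slack y c - slack x c).
Proof.
case: c => [[j i]|i] /=; first by rewrite !mxE.
under eq_bigr do rewrite !mxE mulrDr mulrCA mulrBr.
rewrite big_split/= -mulr_sumr sumrB; ring.
Qed.

Lemma partial_lp_line x y s : K x -> K y ->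
  (forall c, 0 <= slack (x + s *: (y - x)) c) -> K (x + s *: (y - x)).
Proof.
move=> [x1 _ _ xN] [y1 _ _ yN] sl; split.
- move=> j jU; under eq_bigr do rewrite !mxE.
  by rewrite big_split/= -mulr_sumr sumrB x1// y1// subrr mulr0 addr0.
- by move=> i; rewrite -subr_ge0; apply: (sl (inr i)).
- by move=> j i _ _; apply: (sl (inl (j, i))).
- by move=> j i h; rewrite !mxE xN// yN// subrr mulr0 addr0.
Qed.

(** Rows of [x] and [y] have equal sums, so if no entry decreases, none increases. Hence the ray
    from [x] through [y] leaves the polytope. *)
Lemma slack_decreases x y : K x -> K y -> y != x ->
  exists c, slack y c < slack x c.
Proof.
move=> Kx Ky yx.
have [/existsP[j /existsP[i yxji]]|] := boolP [exists j, exists i, y j i < x j i].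
  by exists (inl (j, i)).
rewrite negb_exists => /forallP h; case/eqP: yx.
have {}h j i : x j i <= y j i.
  by have := h j; rewrite negb_exists => /forallP/(_ i); rewrite -leNgt.
have [x1 _ _ xN] := Kx; have [y1 _ _ yN] := Ky.
apply/matrixP => j i; have [/andP[jU pT]|hN] := boolP ((j \in U) && (p j i <= T)%N).
  have/eqP := y1 j jU; rewrite -(x1 j jU) -subr_eq0 -sumrB psumr_eq0.
    by move/allP/(_ i (mem_index_enum _)); rewrite pT subr_eq0 => /eqP.
  by move=> k _; rewrite subr_ge0.
by rewrite xN// yN.
Qed.

(* A feasible point that is not a vertex lies inside a segment of the polytope;
   along its line, every tight constraint stays tight until a further one
   becomes tight. *)
Lemma exists_vertex x : K x -> exists y, vertex K y.
Proof.
have [N] := ubnP #|[set c | slack x c != 0]|; elim: N => // N IHN in x *.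
rewrite ltnS => xN Kx; have [|xnv] := classic (vertex K x); first by exists x.
have [y [z [a [Ky Kz /andP[a0 a1] xyz yx]]]] : exists y z a,
    [/\ K y, K z, 0 < a < 1, x = a *: y + (1 - a) *: z & y != x].
  apply: NNPP => h; apply: xnv; split=> // y z a Ky Kz a0 a1 xyz.
  have yx : y = x.
    by apply/eqP/negP => /negP yx; apply: h; exists y, z, a; rewrite a0.
  have : (1 - a) *: (z - x) = (a *: y + (1 - a) *: z) - x.
    by rewrite yx; apply/matrixP=> j i; rewrite !mxE; ring.
  rewrite -xyz subrr => /eqP; rewrite scaler_eq0 subr_eq0 gt_eqF//= subr_eq0 => /eqP.
  by split.
(* A positive combination of two nonnegative slacks vanishes only if both do. *)
have tight c : slack x c = 0 -> slack y c = 0.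
  move=> xc; have := slack_line y z (1 - a) c.
  have -> : y + (1 - a) *: (z - y) = x.
    by rewrite xyz; apply/matrixP=> j i; rewrite !mxE; ring.
  rewrite xc => e; have y0 := slack_ge0 c Ky; have z0 := slack_ge0 c Kz.
  have e' : 0 = a * slack y c + (1 - a) * slack z c by rewrite e; ring.
  have : 0 <= a * slack y c by rewrite mulr_ge0// ltW.
  have : 0 <= (1 - a) * slack z c by rewrite mulr_ge0// subr_ge0 ltW.
  move=> h1 h2; have /eqP : a * slack y c = 0 by lra.
  by rewrite mulf_eq0 gt_eqF//= => /eqP.
have [c0 c0P] := slack_decreases Kx Ky yx.
(* The parameter at which constraint [c] becomes tight on the ray from [x] through [y]; the least
   one is where the ray leaves the polytope. *)
pose ratio c := slack x c / (slack x c - slack y c).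
have [c cP cmin] := @Order.TotalTheory.arg_minP _ _ _ c0
  (fun c => slack y c < slack x c) ratio c0P.
have xyc : 0 < slack x c - slack y c by rewrite subr_gt0.
have ratio0 : 0 <= ratio c by rewrite divr_ge0 ?slack_ge0// ltW.
have Kx' : K (x + ratio c *: (y - x)).
  apply: partial_lp_line => // d; rewrite slack_line.
  have [dP|dP] := ltP (slack y d) (slack x d); last first.
    by rewrite addr_ge0 ?slack_ge0// mulr_ge0// subr_ge0.
  have := cmin d dP; rewrite {2}/ratio ler_pdivlMr ?subr_gt0// => h; lra.
apply: (IHN _ _ Kx'); apply: leq_trans xN; apply: proper_card.
apply/properP; split.
  apply/subsetP => d; rewrite !inE; apply: contraNN => /eqP xd.
  by rewrite slack_line xd (tight _ xd) subrr mulr0 addr0.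
exists c; rewrite !inE.
  by apply/eqP => xc; rewrite xc (tight _ xc) ltxx in cP.
rewrite negbK slack_line /ratio; apply/eqP; field; exact: lt0r_neq0.
Qed.

Lemma machine_load_le x i : K x ->
  (t i)%:R + \sum_(j in U) (p j i)%:R * x j i <= T%:R.
Proof.
case=> _ xT _ xN; rewrite -lerBrDl; apply: le_trans (xT i).
rewrite (bigID (fun j => p j i <= T)%N)/= [X in _ + X]big1 ?addr0// => j.
by case/andP=> jU pT; rewrite xN ?mulr0// jU.
Qed.

End PartialLP.

(** Classical, since LP feasibility is a mere [Prop]. *)
Lemma exists_least (P : nat -> Prop) (k : nat) : P k ->
  exists2 l, P l & forall k', P k' -> (l <= k')%N.
Proof.
elim/ltn_ind: k => k IHk Pk.
have [[l [lk Pl]]|h] := classic (exists l, (l < k)%N /\ P l); first exact: IHk Pl.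
by exists k => // l Pl; rewrite leqNgt; apply/negP => lk; apply: h; exists l.
Qed.

(** * Bounding a single node *)

Section Nodes.
Context (R : realFieldType) (n m : nat) (p : 'I_n -> 'I_m -> nat).
Implicit Types (F : seq ('I_n * 'I_m)) (sigma : schedule n m) (v c : bb_node R n m).

Definition extends F sigma := forall z, z \in F -> sigma z.1 = z.2.

Lemma mem_unfixed F j : (j \in unfixed F) = (j \notin map fst F).
Proof. by rewrite inE. Qed.

Lemma load_split F sigma i : uniq (map fst F) -> extends F sigma ->
  (\sum_(j | sigma j == i) p j i =
   overhead p F i + \sum_(j in unfixed F | sigma j == i) p j i)%N.
Proof.
move=> uF sF; rewrite (bigID (mem (unfixed F)))/= addnC; congr (_ + _)%N; last first.
  by apply: eq_bigl => j; rewrite andbC.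
rewrite /overhead -[RHS]big_filter.
have -> : [seq z <- F | z.2 == i] = [seq z <- F | sigma z.1 == i].
  by apply: eq_in_filter => z /sF ->.
rewrite big_filter -(big_map fst (fun j => sigma j == i) (fun j => p j i)).
rewrite -[RHS]big_filter [RHS]big_uniq ?filter_uniq//.
by apply: eq_bigl => j; rewrite mem_filter mem_unfixed negbK.
Qed.

Lemma load_le_makespan sigma i : (\sum_(j | sigma j == i) p j i <= makespan p sigma)%N.
Proof. exact: (bigop.leq_bigmax (F := fun i => \sum_(j | sigma j == i) p j i)%N). Qed.

Lemma time_le_makespan sigma j : (p j (sigma j) <= makespan p sigma)%N.
Proof.
apply: leq_trans (load_le_makespan sigma (sigma j)).
by rewrite (bigD1 j)//= leq_addr.
Qed.

(** The 0/1 matrix of [sigma] is feasible, as no job used takes longer than the makespan. This makes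
    [lb] a lower bound for all schedules in the subtree. *)
Lemma node_lp_schedule F sigma : uniq (map fst F) -> extends F sigma ->
  exists x : 'M[R]_(n, m), node_lp p F (makespan p sigma) x.
Proof.
move=> uF sF; set T := makespan p sigma.
exists (\matrix_(j, i) ((j \in unfixed F) && (sigma j == i))%:R); split.
- move=> j jU; rewrite (bigD1 (sigma j)) ?time_le_makespan//= mxE jU eqxx big1 ?addr0//.
  by move=> i /andP[_ /negPf si]; rewrite mxE [sigma j == i]eq_sym si andbF.
- move=> i; rewrite lerBrDl.
  have := load_le_makespan sigma i; rewrite (load_split i uF sF) -(ler_nat R) natrD.
  apply: le_trans; rewrite lerD2l natr_sum [leRHS]big_mkcondr/= big_mkcondr/=.
  apply: ler_sum => j jU; rewrite mxE jU/=.
  by case: (sigma j == i); case: ifP; rewrite ?mulr1 ?mulr0// ler0n.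
- by move=> j i _ _; rewrite mxE ler0n.
- move=> j i; rewrite mxE negb_and; case: (j \in unfixed F) => //=.
  by case: eqP => // <-; rewrite time_le_makespan.
Qed.

Lemma uniq_fst_inj F z w : uniq (map fst F) -> z \in F -> w \in F ->
  z.1 = w.1 -> z = w.
Proof.
elim: F => //= u F IHF /andP[uF /IHF{}IHF].
rewrite !inE => /predU1P[->|zF] /predU1P[->|wF]// e.
- by rewrite e map_f in uF.
- by rewrite -e map_f in uF.
- exact: IHF.
Qed.

Lemma exists_extension F (i0 : 'I_m) : uniq (map fst F) ->
  exists sigma, extends F sigma.
Proof.
move=> uF; have [j|f fP] := @fin_all_exists _ _ (fun (j : 'I_n) (i : 'I_m) =>
    forall z, z \in F -> z.1 = j -> i = z.2).
  have [/mapP[w wF ->]|jF] := boolP (j \in map fst F).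
    by exists w.2 => z zF /(uniq_fst_inj uF zF wF) ->.
  by exists i0 => z zF zj; rewrite -zj map_f in jF.
by exists (finfun f) => z zF; rewrite ffunE; apply: fP.
Qed.

Lemma exists_bounded F : (0 < m)%N -> uniq (map fst F) ->
  exists v, fixed v = F /\ bounded p v.
Proof.
move=> m0 uF.
have [sigma0 /(node_lp_schedule uF) lp0] := exists_extension (Ordinal m0) uF.
have [T [x0 Tx0] Tmin] :=
  exists_least (P := fun T => exists x : 'M[R]_(n, m), node_lp p F T x) lp0.
have [x vx] := exists_vertex Tx0.
pose frac j := (j \in unfixed F) && [exists i, (x j i != 0) && (x j i != 1)].
(* Rounding, job by job: the clauses treat fixed, integral and fractional jobs. *)
have [j|f fP] := @fin_all_exists _ _ (fun (j : 'I_n) (i : 'I_m) =>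
    [/\ forall z, z \in F -> z.1 = j -> i = z.2,
        j \in unfixed F -> ~~ frac j -> x j i = 1
      & frac j -> p j i = minval (p j)]).
  have [jF|jU] := boolP (j \in map fst F).
    have jN : j \in unfixed F = false by rewrite mem_unfixed jF.
    have [w wF jw] := mapP jF.
    exists w.2; rewrite /frac jN; split=> // z zF zj.
    by rewrite (uniq_fst_inj uF zF wF)// zj.
  have jF z : z \in F -> z.1 <> j by move=> zF zj; rewrite -zj map_f in jU.
  rewrite -mem_unfixed in jU.
  have [jfrac|jint] := boolP (frac j).
    have [i pi] := minval_attained (p j) (Ordinal m0).
    by exists i; split=> // z /jF.
  have [i xi] : exists i, x j i == 1.
    apply/existsP; apply: contraNT jint; rewrite negb_exists => /forallP x1.
    rewrite /frac jU; apply: contraT => /=; rewrite negb_exists => /forallP x0'.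
    have /eqP := sum_job vx.1 jU; rewrite big1 ?(eq_sym 0) ?oner_eq0// => i _.
    by apply/eqP; have := x0' i; rewrite x1 andbT negbK.
  by exists i; split=> [z /jF//|_ _|//]; apply/eqP.
exists (BBNode F T x (finfun f)); split=> //; split=> //=.
- by move=> z zF; rewrite ffunE; have [/(_ z zF erefl)] := fP z.1.
- by move=> j jU jN; rewrite ffunE; have [_ ->] := fP j.
- by move=> j jf; rewrite ffunE; have [_ _ ->] := fP j.
Qed.

(** On each machine the LP already charges the fixed and integral jobs; at worst all fractional jobs
    are rounded to that same machine. *)
Lemma ub_le_sum v : uniq (map fst (fixed v)) -> bounded p v ->
  (ub p v <= lb v + \sum_(j | fractional v j) minval (p j))%N.
Proof.
move=> uF [_ [lpv _] vF vint vfrac]; apply/bigop.bigmax_leqP => i _.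
rewrite (load_split i uF vF) (bigID (fractional v))/= addnCA addnC leq_add//.
  rewrite -(ler_nat R) natrD; apply: le_trans (machine_load_le i lpv).
  rewrite lerD2l natr_sum big_mkcondr/= big_mkcondr/=; apply: ler_sum => j jU.
  case: eqP => [ji|_]; last by rewrite mulr_ge0// (partial_lp_ge0 _ _ lpv).
  case: ifPn => [/(vint j jU)|_]; last by rewrite mulr_ge0// (partial_lp_ge0 _ _ lpv).
  by rewrite ji => ->; rewrite mulr1.
rewrite big_mkcond [leqRHS]big_mkcond/= leq_sum// => j _.
case: ifP => // /andP[/andP[_ /eqP <-] jf]; by rewrite jf vfrac.
Qed.

Lemma ub_le v j : uniq (map fst (fixed v)) -> bounded p v -> branching_job p v j ->
  (ub p v <= lb v + m * minval (p j))%N.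
Proof.
move=> uF bv [_ jmax]; apply: leq_trans (ub_le_sum uF bv) _; rewrite leq_add2l.
apply: (@leq_trans (\sum_(j' | fractional v j') minval (p j))%N); first exact: leq_sum.
rewrite sum_nat_const leq_mul2r; apply/orP; right.
have [_ /card_split_jobs le_m _ _ _] := bv; apply: leq_trans le_m.
by apply: subset_leq_card; apply/subsetP => k; rewrite inE.
Qed.

Lemma ub_le_lb v : uniq (map fst (fixed v)) -> bounded p v ->
  (forall j, ~~ fractional v j) -> (ub p v <= lb v)%N.
Proof.
move=> uF bv vN; apply: leq_trans (ub_le_sum uF bv) _.
by rewrite big_pred0 ?addn0// => j; apply: negbTE.
Qed.

Lemma exists_branching_job v : uniq (map fst (fixed v)) -> bounded p v ->
  (lb v < ub p v)%N -> exists j, branching_job p v j.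
Proof.
move=> uF bv lu; have [/existsP[j0 j0f]|] := boolP [exists j, fractional v j].
  by case: (arg_maxnP (fun j => minval (p j)) j0f) => j; exists j.
by rewrite negb_exists => /forallP/(ub_le_lb uF bv); rewrite leqNgt lu.
Qed.

Lemma fractional_machines v j : bounded p v -> fractional v j -> (1 < m)%N.
Proof.
move=> [_ [lpv _] _ _ _] /andP[jU jf].
have [[a b] [/= ab _ _]] := split_job_two_machines lpv jU jf.
rewrite ltnNge; apply: contra ab => m1; apply/eqP/val_inj => /=.
by case: a b => [[|a] am] [[|b] bm]//=; have := leq_trans am m1; have := leq_trans bm m1.
Qed.

(** Sum the LP constraints over all machines: each fixed job counts at least its minimal time, and
    so does [j], whose fractions add up to [1]. *)
Lemma total_load_le v j : bounded p v -> j \in unfixed (fixed v) ->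
  (\sum_(z <- fixed v) minval (p z.1) + minval (p j) <= m * lb v)%N.
Proof.
move=> [_ [lpv _] _ _ _] jU; set F := fixed v in lpv jU *.
have : \sum_i ((overhead p F i)%:R + \sum_(j in unfixed F) (p j i)%:R * lpsol v j i)
    <= \sum_(i < m) (lb v)%:R.
  by apply: ler_sum => i _; apply: machine_load_le.
rewrite sumr_const card_ord -mulrnA mulnC => h; rewrite -(ler_nat R).
apply: le_trans h; rewrite natrD big_split/= lerD//.
  rewrite -natr_sum ler_nat /overhead (exchange_big_dep xpredT)//= leq_sum// => z _.
  by rewrite (big_pred1 z.2)// minval_le.
rewrite exchange_big (bigD1 j)//= -[leLHS]addr0 lerD//.
  rewrite -[leLHS]mulr1 -[X in _ * X <= _](sum_job lpv jU) mulr_sumr ler_sum// => i _.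
  by rewrite ler_wpM2r ?ler_nat ?minval_le// (partial_lp_ge0 _ _ lpv).
apply: sumr_ge0 => k _; apply: sumr_ge0 => i _.
by apply: mulr_ge0 => //; apply: partial_lp_ge0 lpv.
Qed.

(** * Monotonicity of lower bounds along the tree *)

Lemma overhead_cons F j i k :
  overhead p ((j, i) :: F) k = (overhead p F k + (i == k) * p j k)%N.
Proof. by rewrite /overhead big_cons/= addnC; case: eqP; rewrite ?mul1n ?addn0. Qed.

Lemma unfixed_cons F j i k :
  (k \in unfixed ((j, i) :: F)) = (k != j) && (k \in unfixed F).
Proof. by rewrite !mem_unfixed/= inE negb_or. Qed.

(** Putting [j] entirely on machine [i] turns the overhead of the child back into LP load of the
    parent. *)
Lemma node_lp_parent F j i T (x : 'M[R]_(n, m)) : j \in unfixed F ->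
  node_lp p ((j, i) :: F) T x -> exists y : 'M[R]_(n, m), node_lp p F T y.
Proof.
move=> jU lpx; have [x1 xT x0 xN] := lpx.
have xj k : x j k = 0 by rewrite xN// unfixed_cons eqxx.
(* The pair must be in S_T to carry a variable; it is, because the overhead of [i] contains
   [p j i]. *)
have ji : (p j i <= T)%N.
  have := machine_load_le i lpx; rewrite overhead_cons eqxx mul1n natrD => h.
  rewrite -(ler_nat R); apply: le_trans h; rewrite -addrA addrC -addrA lerDl.
  by rewrite addr_ge0// sumr_ge0// => k _; rewrite mulr_ge0// (partial_lp_ge0 _ _ lpx).
exists (x + delta_mx j i); split.
- move=> k kU; have [->|kj] := eqVneq k j.
    rewrite (bigD1 i)//= !mxE xj !eqxx add0r big1 ?addr0// => l /andP[_ /negPf li].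
    by rewrite !mxE xj li andbF add0r.
  rewrite -(x1 k) ?unfixed_cons ?kj//; apply: eq_bigr => l _.
  by rewrite !mxE (negPf kj) addr0.
- move=> k; rewrite lerBrDl; apply: le_trans (machine_load_le k lpx).
  rewrite overhead_cons natrD -addrA lerD2l.
  rewrite big_mkcondr/= (bigD1 j)//= [leRHS]addrC [leLHS]addrC lerD//.
    rewrite [leRHS](eq_bigl (fun l => (l \in unfixed F) && (l != j))); last first.
      by move=> l; rewrite unfixed_cons andbC.
    apply: ler_sum => l /andP[lU lj]; rewrite !mxE (negPf lj) addr0; case: ifP => // _.
    by rewrite mulr_ge0// (partial_lp_ge0 _ _ lpx).
  rewrite !mxE xj eqxx add0r [k == i]eq_sym /=.
  by case: eqP => [<-|_]; rewrite ?ji ?mul1n ?mulr1// mul0n mulr0; case: ifP.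
- by move=> k l _ _; rewrite !mxE addr_ge0 ?ler0n// (partial_lp_ge0 _ _ lpx).
- move=> k l h; rewrite !mxE xN ?add0r.
    by case: eqP h => //= ->; case: eqP => //= ->; rewrite jU ji.
  by rewrite unfixed_cons -andbA negb_and h orbT.
Qed.

Lemma lb_child v c j i : j \in unfixed (fixed v) -> fixed c = (j, i) :: fixed v ->
  bounded p v -> bounded p c -> (lb v <= lb c)%N.
Proof.
move=> jU cF [vmin _ _ _ _] [_ [lpc _] _ _ _]; apply: vmin.
by rewrite cF in lpc; apply: node_lp_parent lpc.
Qed.

Lemma lb_le_makespan v sigma : uniq (map fst (fixed v)) -> bounded p v ->
  extends (fixed v) sigma -> (lb v <= makespan p sigma)%N.
Proof. by move=> uF [vmin _ _ _ _] /(node_lp_schedule uF)/vmin. Qed.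
End Nodes.

(** * Equality of nodes, for membership in active lists, and tree sizes *)

Section NodeEqType.
Context (R : eqType) (n m : nat).

Definition tuple_of_node (v : bb_node R n m) :=
  (fixed v, lb v, lpsol v, rounded v).

Definition node_of_tuple (u : seq ('I_n * 'I_m) * nat * 'M[R]_(n, m) * schedule n m) :=
  let: (F, l, x, sigma) := u in BBNode F l x sigma.

Lemma tuple_of_nodeK : cancel tuple_of_node node_of_tuple.
Proof. by case. Qed.

HB.instance Definition _ := Equality.copy (bb_node R n m) (can_type tuple_of_nodeK).
End NodeEqType.

(* Number of nodes at depths [d, ..., D - 1] in the complete [m]-ary tree below
   a node at depth [d]. *)
Definition tree_size (m D d : nat) : nat := (\sum_(e < D - d) m ^ e)%N.

Lemma tree_sizeS m D d : (d < D)%N ->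
  tree_size m D d = (m * tree_size m D d.+1).+1.
Proof.
move=> dD; rewrite /tree_size -(@prednK (D - d)%N) ?subn_gt0// -subnS big_ord_recl.
by rewrite big_distrr/= add1n; congr _.+1; apply: eq_bigr => e _; rewrite -expnS.
Qed.

(** Strictness leaves room for the node under examination, beyond the branched ones. *)
Lemma tree_size0_lt m D : (1 < m)%N -> (tree_size m D 0 < m ^ D)%N.
Proof.
move=> m1; rewrite /tree_size subn0; elim: D => [|D IHD]; first by rewrite big_ord0.
rewrite big_ord_recr/= expnS; apply: (@leq_trans (m ^ D + m ^ D)%N).
  by rewrite ltn_add2r.
by rewrite addnn -mul2n leq_mul2r m1 orbT.
Qed.

(** * Invariant of a run, progress and approximation *)

Section Algorithm.
Context (R : archiRealFieldType) (n m : nat) (p : 'I_n -> 'I_m -> nat).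
Implicit Types (v c w : bb_node R n m) (s : bb_state R n m) (sigma : schedule n m).

(** [T] is the incumbent makespan. The last clause is [ub_le] inherited from the ancestor that
    branched on [z.1]. A new child is only eligible; it becomes [sound] once its rounding has
    competed with the incumbent. *)
Definition eligible (T : nat) v :=
  [/\ uniq (map fst (fixed v)), bounded p v
    & forall z, z \in fixed v -> (T <= lb v + m * minval (p z.1))%N].

Definition sound (T : nat) v := eligible T v /\ (T <= ub p v)%N.

Lemma eligibleW T T' v : (T' <= T)%N -> eligible T v -> eligible T' v.
Proof. by move=> TT [uF bv vF]; split=> // z /vF; apply: leq_trans. Qed.

Lemma soundW T T' v : (T' <= T)%N -> sound T v -> sound T' v.
Proof.
by move=> TT [ev Tub]; split; [apply: eligibleW ev | apply: leq_trans Tub].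
Qed.

(* With [g = T - lb v > eps * lb v], each job fixed on the path and the
   branching job has all its processing times at least [g / m], whereas the
   total load is at most [m * lb v]. *)
Lemma depth_lt (eps : R) T v j : 0 < eps -> sound T v ->
  (1 + eps) * (lb v)%:R < T%:R -> branching_job p v j ->
  (size (fixed v) < Num.truncn (m%:R ^+ 2 / eps))%N.
Proof.
move=> eps0 [[uF bv vF] Tub] Tlb jb.
have jT : (T <= lb v + m * minval (p j))%N := leq_trans Tub (ub_le uF bv jb).
have /andP[jU _] := jb.1.
pose g : R := T%:R - (lb v)%:R.
have gP k : (T <= lb v + m * minval (p k))%N -> g <= m%:R * (minval (p k))%:R.
  by rewrite /g lerBlDl -natrM -natrD ler_nat.
have g_lb : eps * (lb v)%:R < g by rewrite ltrBrDl; move: Tlb; rewrite mulrDl mul1r.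
(* The total load bound times [m]; the successor counts the branching job. *)
have load : (size (fixed v)).+1%:R * g <= m%:R ^+ 2 * (lb v)%:R.
  have := total_load_le bv jU; rewrite -(ler_nat R) natrD natrM natr_sum => h.
  rewrite expr2 -mulrA; apply: le_trans (ler_wpM2l (ler0n _ m) h).
  rewrite -natr1 mulrDl mul1r [leRHS]mulrDr lerD ?gP// mulr_sumr mulr_natl.
  rewrite -[leLHS]addr0 -iter_addr -count_predT -big_const_seq.
  by rewrite !big_seq; apply: ler_sum => z /vF/gP.
(* Needed to cancel [lb v]; for [lb v = 0], [load] would contradict [0 < g]. *)
have lb0 : (0 < lb v)%N.
  rewrite lt0n; apply: contraTneq load => lb0; rewrite lb0 mulr0 -ltNge.
  by rewrite mulr_gt0 ?ltr0n//; move: g_lb; rewrite lb0 mulr0.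
rewrite truncn_gt_nat ler_pdivlMr// -(ler_pM2r (x := (lb v)%:R)) ?ltr0n//.
by apply: le_trans load; rewrite -mulrA ler_wpM2l// ltW.
Qed.

(** Ensures that pruning and branching lose no schedule better than the incumbent; used at
    termination for an optimal schedule. *)
Definition covered s sigma :=
  (makespan p (incumbent s) <= makespan p sigma)%N \/
  exists2 v, v \in active s & extends (fixed v) sigma.

Lemma incumbent_add_child s c :
  (makespan p (incumbent (add_child p s c)) <= makespan p (incumbent s))%N.
Proof. by rewrite /add_child; case: ifP => //= _; case: ifP => // /ltnW. Qed.

Lemma sound_add_child s c : eligible (makespan p (incumbent s)) c ->
  {in active s, forall v, sound (makespan p (incumbent s)) v} ->
  let s' := add_child p s c in
  {in active s', forall v, sound (makespan p (incumbent s')) v}.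
Proof.
move=> ec es s' v; have s's : (_ <= _)%N := incumbent_add_child s c.
have old : v \in active s -> sound (makespan p (incumbent s')) v.
  by move=> /es; apply: soundW.
have -> : active s' =
    if (makespan p (incumbent s) < lb c)%N then active s else c :: active s.
  by rewrite /s' /add_child; case: ifP.
case: ifP => // h; rewrite inE => /predU1P[->|//].
split; first exact: eligibleW ec.
by rewrite /s' /add_child h/=; case: ltnP.
Qed.

Lemma covered_add_child s c sigma : covered s sigma -> covered (add_child p s c) sigma.
Proof.
move=> [le|[v vs ext]].
  by left; apply: leq_trans le; apply: incumbent_add_child.
by right; exists v => //; rewrite /add_child; case: ifP => //= _; rewrite inE vs orbT.
Qed.

(** If [c] is pruned, its lower bound shows that [sigma] does not beat the incumbent. *)
Lemma covered_new_child s c sigma T : eligible T c -> extends (fixed c) sigma ->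
  covered (add_child p s c) sigma.
Proof.
move=> [uF bc _] ext; rewrite /add_child; case: ifP => [h|_].
  by left; apply: leq_trans (ltnW h) (lb_le_makespan uF bc ext).
by right; exists c => //=; rewrite mem_head.
Qed.

Lemma weight_add_child (W : bb_node R n m -> nat) s c :
  (\sum_(v <- active (add_child p s c)) W v <= W c + \sum_(v <- active s) W v)%N.
Proof.
by rewrite /add_child; case: ifP => _ /=; rewrite ?big_cons// leq_addl.
Qed.

Lemma add_children s (cs : seq (bb_node R n m)) :
  {in active s, forall v, sound (makespan p (incumbent s)) v} ->
  {in cs, forall c, eligible (makespan p (incumbent s)) c} ->
  let s' := foldl (add_child p) s cs in
  [/\ {in active s', forall v, sound (makespan p (incumbent s')) v},
      forall sigma, covered s sigma -> covered s' sigma,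
      forall sigma c, c \in cs -> extends (fixed c) sigma -> covered s' sigma
    & forall W : bb_node R n m -> nat, (\sum_(v <- active s') W v <=
        \sum_(c <- cs) W c + \sum_(v <- active s) W v)%N].
Proof.
elim: cs s => [|c cs IHcs] s es ecs /=.
  by split=> // W; rewrite big_nil.
have ec := ecs c (mem_head _ _).
have [||h1 h2 h3 h4] := IHcs (add_child p s c).
- exact: sound_add_child.
- move=> c' c'cs; apply: (eligibleW (incumbent_add_child s c)).
  by apply: ecs; rewrite inE c'cs orbT.
split=> //.
- by move=> sigma /(covered_add_child c)/h2.
- move=> sigma c'; rewrite inE => /predU1P[->|c'cs] ext; last exact: h3 c'cs ext.
  exact/h2/(covered_new_child _ ec ext).
- move=> W; apply: leq_trans (h4 W) _; rewrite big_cons addnAC [leqLHS]addnC leq_add2r.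
  exact: weight_add_child.
Qed.

(** The third clause is a potential: branched nodes plus the room left below active nodes, down to
    depth [D], never exceed the full tree. The last one excludes [m = 1], where [tree_size0_lt]
    fails. *)
Definition invariant D k s :=
  [/\ {in active s, forall v, sound (makespan p (incumbent s)) v},
      forall sigma, covered s sigma,
      (k + \sum_(v <- active s) tree_size m D (size (fixed v)) <= tree_size m D 0)%N
    & (0 < k -> 1 < m)%N].

Lemma invariant_init D s : bb_init p s -> invariant D 0 s.
Proof.
move=> [v [vF bv ->]]; split=> //=.
- move=> w; rewrite inE => /eqP->; split; last exact: leqnn.
  by split; rewrite ?vF.
- by move=> sigma; right; exists v; rewrite ?mem_head// vF.
- by rewrite big_seq1 vF.
Qed.

(** Some active node fails the stopping test, hence so does one of least bound. *)
Lemma lb_min_lt (eps : R) s v : 0 < eps -> ~~ bb_done p eps s ->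
  all (fun w => lb v <= lb w)%N (active s) ->
  (1 + eps) * (lb v)%:R < (makespan p (incumbent s))%:R.
Proof.
move=> eps0 /allPn[w ws]; rewrite -ltNge => h /allP/(_ w ws) vw.
by apply: le_lt_trans h; rewrite ler_wpM2l ?ler_nat// addr_ge0// ltW.
Qed.

Lemma invariant_step (eps : R) k s s' : 0 < eps ->
  let D := Num.truncn (m%:R ^+ 2 / eps) in
  invariant D k s -> bb_step p eps s s' -> invariant D k.+1 s'.
Proof.
move=> eps0 D + st.
case: st => A1 A2 v sigma j child ndone vmin jb childP [snd cov kD _].
have vA : v \in A1 ++ v :: A2 by rewrite mem_cat mem_head orbT.
have sv := snd v vA; have [[uF bv vF] Tub] := sv.
have jU : j \in unfixed (fixed v) by case/andP: jb.1.
have dD : (size (fixed v) < D)%N := depth_lt eps0 sv (lb_min_lt eps0 ndone vmin) jb.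
set s0 := BBState (A1 ++ A2) sigma; set cs := [seq child i | i <- enum 'I_m].
have [||h1 h2 h3 h4] := @add_children s0 cs.
- by move=> w; rewrite mem_cat => wA; apply: snd; rewrite mem_cat inE orbCA wA orbT.
- move=> _ /mapP[i _ ->]; have [cF bc] := childP i.
  have vc := lb_child jU cF bv bc.
  (* For the newly fixed job the inequality comes from [ub_le] at [v], for older ones from [v]
     itself; [vc] carries both to the child. *)
  split=> //; first by rewrite cF/= uF -mem_unfixed jU.
  move=> z; rewrite cF inE => /predU1P[->|/vF Tz].
    apply: leq_trans Tub _; apply: leq_trans (ub_le uF bv jb) _.
    by rewrite leq_add2r.
  by apply: leq_trans Tz _; rewrite leq_add2r.
split=> //.
- move=> tau; have [le|[w]] := cov tau; first by apply: h2; left.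
  rewrite mem_cat inE orbCA => /predU1P[->|wA] ext; last first.
    by apply: h2; right; exists w; rewrite ?mem_cat.
  (* A schedule below [v] continues into the child that fixes [j] as it does. *)
  apply: (h3 tau (child (tau j))); first by rewrite map_f ?mem_enum.
  by move=> z; have [-> _] := childP (tau j); rewrite inE => /predU1P[->|/ext].
(* As [v] has depth below [D], its weight is [1] plus the weights of [m] children; the [1] pays for
   the increment of [k]. *)
- apply: leq_trans kD; rewrite addSnnS leq_add2l /=.
  rewrite big_cat big_cons/= addnCA -big_cat/= (tree_sizeS _ dD) addSn ltnS.
  apply: leq_trans (h4 _) _; rewrite leq_add2r big_map.
  rewrite (eq_bigr (fun=> tree_size m D (size (fixed v)).+1)); last first.
    by move=> i _; have [-> _] := childP i.
  by rewrite big_enum sum_nat_const card_ord.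
- by move=> _; apply: fractional_machines bv jb.1.
Qed.

Lemma exists_min_lb (A : seq (bb_node R n m)) v0 : v0 \in A ->
  exists2 v, v \in A & all (fun w => lb v <= lb w)%N A.
Proof.
move=> v0A; have [|l [v [vA <-]] vmin] :=
  @exists_least (fun l => exists v, v \in A /\ lb v = l) (lb v0); first by exists v0.
by exists v => //; apply/allP => w wA; apply: vmin; exists w.
Qed.

Lemma exists_step (eps : R) D k s : (0 < m)%N -> 0 < eps -> invariant D k s ->
  ~~ bb_done p eps s -> exists s', bb_step p eps s s'.
Proof.
move=> m0 eps0 [snd _ _ _] ndone; have /allPn[v0 v0A _] := ndone.
have [v vA vmin] := exists_min_lb v0A.
have [[uF bv _] Tub] := snd v vA.
have lT := lb_min_lt eps0 ndone vmin.
have [|j jb] := exists_branching_job uF bv.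
  (* [lb v] lies below the incumbent makespan, which is at most [ub p v], so a fractional job
     exists. *)
  apply: leq_trans Tub; rewrite -(ltr_nat R); apply: le_lt_trans lT.
  by rewrite ler_peMl// lerDl ltW.
have jU : j \in unfixed (fixed v) by case/andP: jb.1.
have [i|child childP] := @fin_all_exists _ _ (fun i (c : bb_node R n m) =>
    fixed c = (j, i) :: fixed v /\ bounded p c).
  by apply: exists_bounded => //=; rewrite uF -mem_unfixed jU.
case: s {snd lT v0A Tub} ndone vmin vA => A sigma /= ndone vmin vA.
move: ndone vmin; case/splitPr: vA => A1 A2 ndone vmin.
by eexists; apply: BBStep ndone vmin jb childP.
Qed.

Lemma done_approx (eps : R) D k s : (0 < m)%N -> 0 < eps -> invariant D k s ->
  bb_done p eps s ->
  (makespan p (incumbent s))%:R <= (1 + eps) * (opt_makespan p)%:R :> R.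
Proof.
move=> m0 eps0 [snd cov _ _] /allP sdone.
have [sigma optE] := minval_attained (fun sigma : schedule n m => makespan p sigma)
  [ffun=> Ordinal m0].
(* Either the incumbent is optimal, or the optimum lies below an active node, whose [lb] it bounds
   from above and which passes the test. *)
rewrite /opt_makespan optE; have [le|[v vA ext]] := cov sigma.
  apply: (@le_trans _ _ (makespan p sigma)%:R); first by rewrite ler_nat.
  by rewrite ler_peMl// lerDl ltW.
apply: le_trans (sdone v vA) _; have [[uF bv _] _] := snd v vA.
by rewrite ler_wpM2l ?ler_nat ?(lb_le_makespan uF bv ext)// addr_ge0// ltW.
Qed.
End Algorithm.

(** The node bound on every reachable state, together with progress while the test fails, yields
    termination whatever choices are made. *)
Theorem theorem2 (R : archiRealFieldType) (m : nat) (hm : (0 < m)%N)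
    (eps : R) (heps : 0 < eps) (n : nat) (p : 'I_n -> 'I_m -> nat) :
  (exists s : bb_state R n m, bb_init p s) /\
  forall (k : nat) (s : bb_state R n m), bb_reach p eps k s ->
    [/\ (k.+1 <= m ^ Num.truncn (m%:R ^+ 2 / eps))%N,
        bb_done p eps s ->
          (makespan p (incumbent s))%:R <= (1 + eps) * (opt_makespan p)%:R
      & ~~ bb_done p eps s -> exists s' : bb_state R n m, bb_step p eps s s'].
Proof.
split.
  have [v [vF bv]] := exists_bounded R p (F := [::]) hm isT.
  by exists (BBState [:: v] (rounded v)), v.
move=> k s reach; set D := Num.truncn _.
have inv : invariant p D k s.
  elim: reach => [s0 /invariant_init//|k' s1 s2 _ inv1 st].
  exact: invariant_step heps inv1 st.
split; [|exact: done_approx hm heps inv|exact: exists_step hm heps inv].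
(* Before any branching, [m] may be [1], and [1 <= m ^ D] suffices. *)
have [_ _ kD km] := inv; case: k kD km {reach inv} => [|k] kD km.
  by rewrite expn_gt0 hm.
apply: leq_ltn_trans (tree_size0_lt D (km isT)).
by apply: leq_trans kD; rewrite leq_addr.
Qed.
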